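(* Let $b\in\mathbb{B}$ and $\tilde b\in\mathbb{B}$. If there exists $\xi_0\in(0,\infty)$ such that $$\varphi_1(x,\xi_0)=\tilde\varphi_1(x,\xi_0),\qquad x\in\mathbb{R},$$ then $\tilde b=b$ (as elements of $L^\infty(\mathbb{R})$).
   Context: Fix real numbers $b_\pm$ with $0<b_-<b_+<3b_-$. $\mathbb{B}$ denotes the set of non-decreasing real-valued functions $b\in L^\infty(\mathbb{R})$ with $\lim_{x\to\pm\infty}b(x)=b_\pm$. For $b\in\mathbb{B}$, let $a(x):=\int_0^x b(s)\,\mathrm{d}s$. For $\xi\in\mathbb{R}$ let $h(\xi)$ be the self-adjoint operator in $L^2(\mathbb{R})$ which acts as $-\frac{\mathrm{d}^2}{\mathrm{d}x^2}+(\xi-a(x))^2$ on $C_0^\infty(\mathbb{R})$, with domain (independent of $\xi$) $\{u\in H^1(\mathbb{R}) : -u''+a^2u\in L^2(\mathbb{R})\}$. It has compact resolvent and simple eigenvalues $\lambda_1(\xi)<\lambda_2(\xi)<\cdots$. Let $\varphi_1(\cdot,\xi)$ be the eigenfunction of $h(\xi)$ associated with its lowest eigenvalue $\lambda_1(\xi)$ that is normalized in $L^2(\mathbb{R})$, real-valued and positive on $\mathbb{R}$. For $\tilde b\in\mathbb{B}$, the function $\tilde\varphi_1(\cdot,\xi)$ is defined in the same way with $b$ replaced by $\tilde b$ (hence $a$ replaced by $\tilde a(x):=\int_0^x\tilde b(s)\,\mathrm{d}s$). *)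

(* Defs.v *)
From HB Require Import structures.
From mathcomp Require Import all_boot all_order all_algebra.
From mathcomp Require Import all_classical all_reals all_analysis.

Set Implicit Arguments.
Unset Strict Implicit.
Unset Printing Implicit Defensive.
Import Order.TTheory GRing.Theory Num.Theory.
Import numFieldNormedType.Exports.

Local Open Scope classical_set_scope.
Local Open Scope ring_scope.

Section magnetic_profiles.
Context {R : realType}.
Local Notation mu := (@lebesgue_measure R).
Implicit Types (b a u v f psi phi V : R -> R) (xi l x : R).

(* Elements of L^p spaces are represented by (Borel measurable) functions;
   they are identified when they agree almost everywhere. *)

Definition profile (bm bp : R) : set (R -> R) := [set b : R -> R |
  [/\ b \in Lfun mu +oo%E,
      {homo b : x y / x <= y},
      b x @[x --> -oo] --> bm
    & b x @[x --> +oo] --> bp]].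

Definition potential b x : R :=
  if 0 <= x then \int[mu]_(s in `[0, x]) b s
  else - \int[mu]_(s in `[x, 0]) b s.

(* C_0^oo(R) *)
Definition test_function : set (R -> R) := [set psi : R -> R |
  (forall n x, derivable (psi^`(n))%classic x 1) /\
  exists M : R, forall x, M < `|x| -> psi x = 0].

(* u' = v in the sense of distributions *)
Definition weak_derivative u v := forall psi, test_function psi ->
  \int[mu]_x (u x * (psi^`())%classic x) = - \int[mu]_x (v x * psi x).

Definition sobolev_H1 : set (R -> R) := [set u : R -> R |
  u \in Lfun mu 2%:E /\
  exists2 v, v \in Lfun mu 2%:E & weak_derivative u v].

(* - u'' + V u = f in the sense of distributions *)
Definition weak_schrodinger V u f := forall psi, test_function psi ->
  \int[mu]_x (u x * (- (psi^`(2))%classic x + V x * psi x)) =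
  \int[mu]_x (f x * psi x).

Definition hamiltonian_domain a : set (R -> R) := [set u : R -> R |
  sobolev_H1 u /\
  exists2 f, f \in Lfun mu 2%:E & weak_schrodinger (fun x => a x ^+ 2) u f].

(* The graph of h(xi): being symmetric, the self-adjoint operator h(xi) acts
   on the whole of its domain in the sense of distributions, i.e. f = h(xi) u
   exactly when f is the L^2 function - u'' + (xi - a)^2 u. *)
Definition hamiltonian a xi u f :=
  [/\ hamiltonian_domain a u, f \in Lfun mu 2%:E
    & weak_schrodinger (fun x => (xi - a x) ^+ 2) u f].

Definition eigenfunction a xi l u :=
  ~ (\forall x \ae mu, u x = 0) /\ hamiltonian a xi u (fun x => l * u x).

Definition eigenvalue a xi : set R :=
  [set l | exists u, eigenfunction a xi l u].

Definition lowest_eigenvalue a xi l :=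
  eigenvalue a xi l /\ forall l', eigenvalue a xi l' -> l <= l'.

(* phi = phi_1(., xi); its L^2 class, being in H^1(R), has a unique continuous
   representative, which gives a meaning to pointwise statements. *)
Definition ground_state b xi phi :=
  [/\ exists2 l, lowest_eigenvalue (potential b) xi l
               & eigenfunction (potential b) xi l phi,
      ('N[mu]_(2%:E)[EFin \o phi] = 1)%E,
      continuous phi
    & forall x, 0 < phi x].

End magnetic_profiles.

(* Main.v *)
Require Import Defs.
From mathcomp Require Import all_boot all_order all_algebra.
From mathcomp Require Import all_classical all_reals all_analysis.
From mathcomp Require Import measurable_realfun ring lra.
Import Order.TTheory GRing.Theory Num.Theory.
Import numFieldNormedType.Exports.
Local Open Scope classical_set_scope.
Local Open Scope ring_scope.

(** Let [phi] be the common ground state, with eigenvalues [l] for [b] and [lt]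
    for [bt], and let [a], [at] be the two vector potentials. Subtracting the weak
    eigenvalue equations, the [phi''] terms cancel:
    [((xi - a) ^ 2 - l) phi = ((xi - at) ^ 2 - lt) phi], first against test
    functions, then everywhere since both sides are continuous
    ([weak_schrodinger_potential_unique]). As [phi > 0] it can be divided out, and
    evaluating at 0, where [a = at = 0], gives [l = lt]. Hence
    [(xi - a) ^ 2 = (xi - at) ^ 2], so that at each point [a = at] or
    [a + at = 2 * xi]. A profile is bounded below by [bm > 0], so [a] and [at]
    increase strictly and the second alternative holds at one point at most; by
    continuity [a = at] ([increasing_reflection_unique]). Finally [b = bt] almost
    everywhere by Lebesgue differentiation ([ae_eq_potential]).

    Testing against a localized function requires smooth bump functions, built
    from [exp (- 1 / q)] for a polynomial [q]. *)

Set Implicit Arguments.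
Unset Strict Implicit.
Unset Printing Implicit Defensive.

(** * Smooth bump functions *)

Section bump.
Context {R : realType}.
Implicit Types (p q : {poly R}) (k : nat) (x z : R).

(** The classical flat function [exp (- 1 / q)], extended by 0 where [q <= 0] and
    multiplied by a rational function [p / q ^ k]. The factor is what makes the
    family stable under differentiation, so that its smoothness only requires
    one derivative to be computed. *)
Definition expinv_poly q k p z : R :=
  if 0 < q.[z] then p.[z] * q.[z]^-1 ^+ k * expR (- q.[z]^-1) else 0.

Lemma expinv_poly0 q k p z : q.[z] <= 0 -> expinv_poly q k p z = 0.
Proof. by rewrite /expinv_poly leNgt => /negbTE ->. Qed.

Lemma expinv_polyS q k p z :
  expinv_poly q k p z = q.[z] * expinv_poly q k.+1 p z.
Proof.
rewrite /expinv_poly; case: ifPn => [q0|_]; last by rewrite mulr0.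
rewrite exprS; field; exact: lt0r_neq0.
Qed.

(** One term of the exponential series suffices: with [t = 1 / q > 0],
    [t ^ (k + 1) / (k + 1)! <= exp t], that is, [t ^ k exp (- t) <= (k + 1)! q]. *)
Lemma norm_expinv_poly_le q k p z :
  `|expinv_poly q k p z| <= `|p.[z] * (k.+1)`!%:R * q.[z]|.
Proof.
rewrite /expinv_poly; case: ifPn => [q0|_]; last by rewrite normr0.
have iq0 : 0 < q.[z]^-1 by rewrite invr_gt0.
rewrite -!mulrA !(normrM p.[z]) ler_wpM2l//.
rewrite !ger0_norm ?mulr_ge0 ?expR_ge0 ?exprn_ge0 ?(ltW iq0) ?(ltW q0)//.
rewrite expRN ler_pdivrMr ?expR_gt0//.
have := expR_ge1Dxn k (ltW iq0); set e := expR _.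
have f0 : 0 < (k.+1)`!%:R :> R by rewrite ltr0n fact_gt0.
move=> H; have {H} : q.[z]^-1 ^+ k.+1 / (k.+1)`!%:R <= e by lra.
rewrite ler_pdivrMr// => H.
have -> : q.[z]^-1 ^+ k = q.[z] * q.[z]^-1 ^+ k.+1.
  by rewrite exprS mulrA divff ?mul1r// lt0r_neq0.
by rewrite -mulrA [leRHS]mulrCA ler_wpM2l 1?mulrC// ltW.
Qed.

Lemma continuous_expinv_poly_at_root q k p x : q.[x] = 0 ->
  {for x, continuous (expinv_poly q k p)}.
Proof.
move=> qx0; rewrite /prop_for /continuous_at expinv_poly0 ?qx0//.
apply/norm_cvg0P; pose B z := `|(p * ((k.+1)`!%:R)%:P * q).[z]|.
have cB : B z @[z --> x] --> (0 : R).
  have -> : (0 : R) = B x by rewrite /B !hornerE qx0 mulr0 normr0.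
  by apply: (cvg_norm (V := R^o)); exact: continuous_horner.
apply: (squeeze_cvgr _ (cvg_cst 0) cB); apply: nearW => z /=.
rewrite normr_ge0 /B !hornerE; exact: norm_expinv_poly_le.
Qed.

(** The numerator of the derivative of [p / q ^ k * exp (- 1 / q)] over the
    denominator [q ^ (k + 2)]. *)
Definition deriv_numer q k p : {poly R} :=
  p^`() * q ^+ 2 - k%:R *: (p * q^`() * q) + p * q^`().

Lemma deriv_numerE k (e P P' Q Q' : R) : Q != 0 ->
  P * Q^-1 ^+ k * (e * - (- Q ^- 2 * Q')) +
    e * (P * (k%:R * Q^-1 ^+ k.-1 * (- Q ^- 2 * Q')) + Q^-1 ^+ k * P') =
  (P' * Q ^+ 2 - k%:R * (P * Q' * Q) + P * Q') * Q^-1 ^+ k.+2 * e.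
Proof.
move=> Q0; case: k => [|k]; first by field.
by rewrite !exprS /=; move: (Q^-1 ^+ k) (k.+1%:R) => uk c; field.
Qed.

(** Only the roots of [q] need an argument. At a root [x], write
    [q = q1 * ('X - x)]; since the function for the exponent [k] is [q] times the
    one for [k + 1], its slope from [x] is [q1] times the latter, which tends to
    0 at [x]. *)
Lemma is_derive_expinv_poly q k p x :
  is_derive x 1 (expinv_poly q k p) (expinv_poly q k.+2 (deriv_numer q k p) x).
Proof.
have [q0|q0|/esym q0] := ltrgt0P q.[x].
- pose f := horner p * (fun z => q.[z]^-1) ^+ k *
    (expR \o (- (fun z => q.[z]^-1))).
  have eqf : \forall z \near x, f z = expinv_poly q k p z.
    have : \forall z \near x, 0 < q.[z].
      exact: (cvgr_gt q.[x] (@continuous_horner _ q x)).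
    by apply: filterS => z qz; rewrite /expinv_poly qz /f !fctE.
  apply: (@near_eq_is_derive _ _ _ _ _ _ _ _ eqf).
  have qx : q.[x] != 0 by exact: lt0r_neq0.
  have dV := is_deriveV qx (is_derive_poly q x).
  have dE := is_derive1_comp (is_derive_expR _) (is_deriveN dV).
  have dX := is_deriveX k dV.
  have df := is_deriveM (is_deriveM (is_derive_poly p x) dX) dE.
  apply: (is_derive_eq df).
  rewrite /expinv_poly q0 /deriv_numer.
  rewrite !(hornerD, hornerN, hornerZ, hornerM, horner_exp).
  by rewrite !fctE; exact: deriv_numerE.
- have eqf : \forall z \near x, cst 0 z = expinv_poly q k p z.
    have : \forall z \near x, q.[z] < 0.
      exact: (cvgr_lt q.[x] (@continuous_horner _ q x)).
    by apply: filterS => z qz; rewrite expinv_poly0 ?ltW.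
  rewrite expinv_poly0 ?ltW//.
  exact: (@near_eq_is_derive _ _ _ _ _ _ _ _ eqf).
- rewrite expinv_poly0 -?q0//.
  have /factor_theorem[q1 qE] : root q x by apply/rootP.
  apply/is_derive1_caratheodory.
  exists (fun z => q1.[z] * expinv_poly q k.+1 p z); split.
  + move=> z; rewrite [in X in _ - X]expinv_poly0 -?q0// subr0 expinv_polyS.
    by rewrite {1}qE !hornerE mulrAC.
  + apply: cvgM; first exact: continuous_horner.
    exact: continuous_expinv_poly_at_root.
  + by rewrite expinv_poly0 -?q0// mulr0.
Qed.

Lemma derive1_expinv_poly q k p :
  ((expinv_poly q k p)^`())%classic = expinv_poly q k.+2 (deriv_numer q k p).
Proof.
apply/funext => x; rewrite derive1E.
by case: (is_derive_expinv_poly q k p x).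
Qed.

Lemma derive1n_expinv_poly q k p n : exists k' p',
  ((expinv_poly q k p)^`(n))%classic = expinv_poly q k' p'.
Proof.
elim: n => [|n [k' [p' IHn]]]; first by exists k, p.
by rewrite derive1nS IHn derive1_expinv_poly; eexists; eexists.
Qed.

Definition bump c r : R -> R :=
  expinv_poly ((r ^+ 2)%:P - ('X - c%:P) ^+ 2) 0 1.

Lemma bump_gt0 c r x : 0 < r -> (0 < bump c r x) = (`|x - c| < r).
Proof.
move=> r0; rewrite /bump /expinv_poly !hornerE.
have -> : (0 < r * r - (x - c) * (x - c)) = (`|x - c| < r).
  rewrite subr_gt0 -!expr2 -real_normK ?num_real// ltr_pXn2r ?nnegrE//.
  exact: ltW.
by case: ifPn => // _; rewrite ?ltxx ?mulr_gt0 ?expR_gt0.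
Qed.

Lemma bump_ge0 c r x : 0 <= bump c r x.
Proof.
by rewrite /bump /expinv_poly !hornerE; case: ifPn => // _; exact: expR_ge0.
Qed.

Lemma bump_test_function c r : test_function (bump c r).
Proof.
split=> [n x|].
  rewrite /bump; set q := (X in expinv_poly X).
  have [k [p ->]] := derive1n_expinv_poly q 0 1 n.
  by case: (is_derive_expinv_poly q k p x).
exists (`|c| + `|r|) => x cx; apply: expinv_poly0.
rewrite !(hornerD, hornerN, horner_exp, hornerC, hornerX) subr_le0.
rewrite -(real_normK (num_real r)) -(real_normK (num_real (x - c))).
rewrite ler_pXn2r ?nnegrE//.
by have := ler_normB x c; have := lerB_dist x c; lra.
Qed.

End bump.

(** * The fundamental lemma of the calculus of variations *)

Section fundamental_lemma.
Context {R : realType}.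
Local Notation mu := (@lebesgue_measure R).
Implicit Types (g u V W psi : R -> R) (x c r M : R).

Lemma continuous_test_function psi : test_function psi -> continuous psi.
Proof.
move=> [dpsi _] x.
by apply/differentiable_continuous/derivable1_diffP; exact: (dpsi 0%N).
Qed.

Lemma test_function_derive1 psi :
  test_function psi -> test_function (psi^`())%classic.
Proof.
move=> [dpsi [M psi0]]; split=> [n x|].
  by rewrite -derive1Sn; exact: dpsi.
exists M => x Mx; rewrite derive1E -(@derive_cst _ _ _ (0 : R) (1 : R) x).
apply: near_eq_derive; have : \forall z \near x, M < `|z|.
  exact: (cvgr_gt `|x| (@norm_continuous _ _ x)).
by apply: filterS => z; exact: psi0.
Qed.

Lemma integrable_continuous_compact_support (f : R -> R) M :
  continuous f -> (forall x, M < `|x| -> f x = 0) ->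
  mu.-integrable setT (EFin \o f).
Proof.
move=> cf f0; have -> : EFin \o f = (EFin \o f) \_ `[- M, M].
  apply/funext => x; rewrite patchE; case: ifPn => // xM.
  rewrite /= f0// ltNge ler_norml; apply/negP => h.
  by move/negP: xM; apply; rewrite inE.
apply/(integrable_mkcond _ _).1 => //.
apply: continuous_compact_integrable; first exact: segment_compact.
exact: continuous_subspaceT.
Qed.

Lemma integrable_mul_test_function g psi :
  continuous g -> test_function psi ->
  mu.-integrable setT (EFin \o (fun x => g x * psi x)).
Proof.
move=> cg tpsi; have [_ [M psi0]] := tpsi.
apply: (@integrable_continuous_compact_support _ M) => [x|x Mx].
  by apply: cvgM; [exact: cg|exact: continuous_test_function].
by rewrite psi0// mulr0.
Qed.

Lemma Rintegral_gt0_continuous (f : R -> R) x :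
  continuous f -> mu.-integrable setT (EFin \o f) ->
  (forall z, 0 <= f z) -> 0 < f x -> 0 < \int[mu]_z f z.
Proof.
move=> cf fint f0 fx0.
have : \forall z \near x, f x / 2 < f z.
  by apply: (cvgr_gt (f x) (cf x)); lra.
move=> /nbhs_ballP[e /= e0 xe]; set B := ball x e.
have mB : measurable B by rewrite /B ball_itv; exact: measurable_itv.
have muB : mu B = (e *+ 2)%:E by exact: lebesgue_measure_ball (ltW e0).
have fB : \int[mu]_(z in B) (f x / 2) <= \int[mu]_z f z.
  rewrite Rintegral_mkcond; apply: le_Rintegral => //.
    rewrite -restrict_EFin; apply/(integrable_mkcond _ _).1 => //.
    apply: measurable_bounded_integrable => //.
      exact: (eq_ind_r (fun y => (y < +oo)%E) (ltry _) muB).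
    by exists `|f x / 2|; split; rewrite ?num_real// => y /ltW fy z _.
  move=> z _; rewrite patchE; case: ifPn => // zB; apply/ltW/xe.
  by rewrite inE in zB.
apply: lt_le_trans fB; rewrite Rintegral_cst//= [mu B]muB /=.
by rewrite mulr_gt0 ?divr_gt0 ?mulrn_wgt0.
Qed.

(** If [g c > 0] then [g > 0] on some ball around [c], and the bump function
    of that ball has a positive integral against [g]. *)
Lemma continuous_orthogonal_test_function g : continuous g ->
  (forall psi, test_function psi -> \int[mu]_x (g x * psi x) = 0) ->
  forall x, g x = 0.
Proof.
wlog suff gle0 : / forall g, continuous g ->
    (forall psi, test_function psi -> \int[mu]_x (g x * psi x) = 0) ->
    forall x, g x <= 0.
  move=> cg g0 x; apply/eqP; rewrite eq_le gle0//= -oppr_le0.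
  apply: (gle0 (fun z => - g z)) => [z|psi tpsi]; first exact/continuousN/cg.
  under eq_Rintegral do rewrite mulNr -mulN1r.
  by rewrite RintegralZl ?g0 ?mulr0//; exact: integrable_mul_test_function.
move=> {}g cg g0 c; rewrite leNgt; apply/negP => gc.
have : \forall z \near c, 0 < g z by exact: (cvgr_gt (g c) (cg c)).
move=> /nbhs_ballP[r /= r0 cr].
have tb := bump_test_function c r.
suff : 0 < \int[mu]_z (g z * bump c r z) by rewrite g0// ltxx.
apply: (@Rintegral_gt0_continuous _ c).
- by move=> z; apply: cvgM; [exact: cg|exact: continuous_test_function].
- exact: integrable_mul_test_function.
- move=> z; have [zr|] := ltP `|z - c| r; last first.
    rewrite leNgt -bump_gt0// -leNgt => b0.
    have -> : bump c r z = 0 by apply/eqP; rewrite eq_le b0 bump_ge0.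
    by rewrite mulr0.
  by rewrite mulr_ge0 ?bump_ge0// ltW// cr//= /ball/= distrC.
- by rewrite mulr_gt0 ?bump_gt0 ?subrr ?normr0.
Qed.

(** The distribution [- u''] is the same in both equations, hence so is the
    remaining, zeroth order, part; being continuous, it is so pointwise. *)
Lemma weak_schrodinger_potential_unique u V W (f g : R -> R) :
  continuous u -> continuous V -> continuous W ->
  continuous f -> continuous g ->
  weak_schrodinger V u f -> weak_schrodinger W u g ->
  forall x, V x * u x - f x = W x * u x - g x.
Proof.
move=> cu cV cW cf cg uVf uWg x; apply/eqP; rewrite -subr_eq0; apply/eqP.
pose h z := V z * u z - f z - (W z * u z - g z).
have cVuf : continuous (fun z => V z * u z - f z).
  by move=> z; apply: cvgB; [apply: cvgM; [exact: cV|exact: cu]|exact: cf].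
have cWug : continuous (fun z => W z * u z - g z).
  by move=> z; apply: cvgB; [apply: cvgM; [exact: cW|exact: cu]|exact: cg].
have ch : continuous h by move=> z; apply: cvgB; [exact: cVuf|exact: cWug].
apply: (@continuous_orthogonal_test_function h) => // psi tpsi {x}.
have tpsi2 := test_function_derive1 (test_function_derive1 tpsi).
have weakE (U k : R -> R) : continuous U -> continuous k ->
    weak_schrodinger U u k ->
    \int[mu]_z ((U z * u z - k z) * psi z) =
    \int[mu]_z (u z * (psi^`(2))%classic z).
  move=> cU ck /(_ _ tpsi) uUk.
  have iu2 := integrable_mul_test_function cu tpsi2.
  have ik := integrable_mul_test_function ck tpsi.
  have iUu : mu.-integrable setT (EFin \o (fun z => U z * u z * psi z)).
    apply: (@integrable_mul_test_function (fun z => U z * u z)) => // z.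
    by apply: cvgM; [exact: cU|exact: cu].
  under eq_Rintegral do rewrite mulrBl.
  rewrite RintegralB// -uUk.
  under [X in _ - X]eq_Rintegral do rewrite mulrDr mulrN addrC mulrCA mulrA.
  by rewrite RintegralB// subKr.
under eq_Rintegral do rewrite mulrBl.
by rewrite RintegralB ?weakE ?subrr//; exact: integrable_mul_test_function.
Qed.

End fundamental_lemma.

(** * The magnetic field is determined by its vector potential *)

Section potential.
Context {R : realType}.
Local Notation mu := (@lebesgue_measure R).
Implicit Types (b : R -> R) (x y : R).

Lemma locally_integrable_itv b x y : locally_integrable setT b ->
  mu.-integrable `[x, y] (EFin \o b).
Proof.
move=> [mb _ bint]; apply/integrableP; split.
  by apply/measurable_EFinP; exact: measurable_funS mb.
by apply: bint => //; exact: segment_compact.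
Qed.

Lemma potential0 b : potential b 0 = 0.
Proof. by rewrite /potential lexx set_itv1 Rintegral_set1. Qed.

Lemma potentialB b x y : locally_integrable setT b -> x <= y ->
  potential b y - potential b x = \int[mu]_(s in `[x, y]) b s.
Proof.
move=> bint xy.
have itvB (z1 z2 z3 : R) : z1 <= z2 -> z2 <= z3 ->
    \int[mu]_(s in `[z1, z3]) b s - \int[mu]_(s in `[z1, z2]) b s =
    \int[mu]_(s in `[z2, z3]) b s.
  move=> z12 z23.
  rewrite Rintegral_itvB ?bnd_simp//; last exact: locally_integrable_itv.
  rewrite Rintegral_itv_obnd_cbnd//.
  by apply: integrableS (locally_integrable_itv z2 z3 bint) => //;
    exact: subset_itv_oc_cc.
rewrite /potential; case: (leP 0 y) => y0; case: (leP 0 x) => x0.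
- exact: itvB.
- by rewrite opprK -(itvB _ _ _ (ltW x0) y0) subrK.
- by have := lt_le_trans y0 (le_trans x0 xy); rewrite ltxx.
- by rewrite opprK addrC -(itvB _ _ _ xy (ltW y0)) subKr.
Qed.

(** Lebesgue differentiation: almost everywhere, the field is the derivative of
    its integral from [- n], which is the increment of the potential. *)
Lemma ae_eq_potential b1 b2 :
  locally_integrable setT b1 -> locally_integrable setT b2 ->
  potential b1 =1 potential b2 -> \forall x \ae mu, b1 x = b2 x.
Proof.
move=> b1int b2int b12.
have aeF : Filter (nbhs (almost_everywhere mu)).
  exact: (ae_filter_ringOfSetsType mu).
pose F b (n : nat) x := \int[mu]_(s in `[- n%:R, x]) b s.
have F12 n : F b1 n = F b2 n.
  apply/funext => x; rewrite /F; have [nx|xn] := leP (- n%:R) x.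
    by rewrite -!potentialB// !b12.
  by rewrite set_itv_ge ?bnd_simp -?ltNge// !Rintegral_set0.
have dF b n : locally_integrable setT b ->
    \forall x \ae mu, - n%:R < x -> ((F b n)^`())%classic x = b x.
  move=> bint.
  have := FTC1 (a := BLeft (- n%:R))
    (fun y => locally_integrable_itv _ y bint) bint.
  by apply: filterS => x h nx; apply: (h _).2; rewrite /= lte_fin.
have : \forall x \ae mu, forall n : nat, - n%:R < x -> b1 x = b2 x.
  apply: ae_foralln => n.
  apply: filterS2 (dF b1 n b1int) (dF b2 n b2int) => x d1 d2 nx.
  by rewrite -d1// -d2// F12.
apply: filterS => x /(_ (Num.truncn `|x|).+1); apply.
by rewrite ltrNl (le_lt_trans (ler_norm _))// normrN truncnS_gt.
Qed.

End potential.

(** * Potentials of magnetic profiles *)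

Section profile.
Context {R : realType} {bm bp : R}.
Local Notation mu := (@lebesgue_measure R).
Implicit Types (b : R -> R) (x y : R).

Lemma profile_ge b x : profile bm bp b -> bm <= b x.
Proof.
move=> [_ ndb bNy _]; rewrite leNgt; apply/negP => bx.
have [y [/ndb yx]] := @filter_ex _ _ _ _
  (filterI (nbhs_ninfty_le (num_real x)) (cvgr_gt bm bNy _ bx)).
by rewrite ltNge yx.
Qed.

Lemma profile_le b x : profile bm bp b -> b x <= bp.
Proof.
move=> [_ ndb _ bpy]; rewrite leNgt; apply/negP => bx.
have [y [/ndb xy]] := @filter_ex _ _ _ _
  (filterI (nbhs_pinfty_ge (num_real x)) (cvgr_lt bp bpy _ bx)).
by rewrite ltNge xy.
Qed.

Lemma profile_locally_integrable b :
  profile bm bp b -> locally_integrable setT b.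
Proof.
move=> pb; split=> [||K _ cK]; [|exact: openT|].
  by apply: nondecreasing_measurable => //; case: pb.
have : mu.-integrable K (EFin \o b).
  apply: measurable_bounded_integrable.
  - exact: compact_measurable.
  - exact: compact_finite_measure.
  - apply: nondecreasing_measurable; first exact: compact_measurable.
    by case: pb.
  exists (Num.max `|bm| `|bp|); split; rewrite ?num_real// => M bM x _ /=.
  have := profile_ge x pb; have := profile_le x pb.
  move: bM; rewrite gt_max => /andP[].
  rewrite !ltr_norml => /andP[? ?] /andP[? ?] ? ?.
  by rewrite ler_norml; apply/andP; split; lra.
by move=> /integrableP[].
Qed.

Lemma potential_profile_bounds b x y : profile bm bp b -> x <= y ->
  bm * (y - x) <= potential b y - potential b x <= bp * (y - x).
Proof.
move=> pb xy; have bint := profile_locally_integrable pb.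
rewrite potentialB//.
have cstint (c : R) : \int[mu]_(_ in `[x, y]) c = c * (y - x).
  rewrite Rintegral_cst//= lebesgue_measure_itv/= lte_fin.
  case: ltgtP xy => // xy _.
  by rewrite xy subrr.
have icst (c : R) : mu.-integrable `[x, y] (EFin \o cst c).
  apply: continuous_compact_integrable; first exact: segment_compact.
  by apply: continuous_subspaceT => z; exact: cvg_cst.
have ib := locally_integrable_itv x y bint.
rewrite -!cstint; apply/andP; split.
  apply: le_Rintegral (icst bm) ib _ => // s _; exact: profile_ge.
apply: le_Rintegral ib (icst bp) _ => // s _; exact: profile_le.
Qed.

Hypothesis bm0 : 0 < bm.

Lemma continuous_potential b : profile bm bp b -> continuous (potential b).
Proof.
move=> pb x; have bp0 : 0 < bp.
  by apply: lt_le_trans bm0 (le_trans (profile_ge 0 pb) (profile_le 0 pb)).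
have lip y : `|potential b x - potential b y| <= bp * `|x - y|.
  wlog xy : x y / x <= y.
    by move=> H; case: (leP x y) => [/H//|/ltW/H]; rewrite distrC (distrC y).
  have /andP[le1 le2] := potential_profile_bounds pb xy.
  rewrite distrC (distrC x) !ger0_norm ?subr_ge0//.
  by rewrite -subr_ge0; apply: le_trans le1; rewrite mulr_ge0 ?subr_ge0// ltW.
apply/cvgrPdist_le => e e0; near=> y.
apply: le_trans (lip y) _; rewrite -ler_pdivlMl//.
near: y; apply: cvgr_dist_le => //.
by rewrite mulr_gt0 ?invr_gt0.
Unshelve. all: by end_near. Qed.

Lemma potential_increasing b : profile bm bp b ->
  {homo potential b : x y / x < y}.
Proof.
move=> pb x y xy; rewrite -subr_gt0.
have /andP[le1 _] := potential_profile_bounds pb (ltW xy).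
by apply: lt_le_trans le1; rewrite mulr_gt0// subr_gt0.
Qed.

End profile.

(** At each point either [a1 = a2] or [a1 + a2 = 2 * xi]. The increasing sum
    [a1 + a2] takes the value [2 * xi] at most once, so [a1 = a2] outside a single
    point, and then there too by continuity. *)
Lemma increasing_reflection_unique {R : realType} (a1 a2 : R -> R) (xi : R) :
  continuous a1 -> continuous a2 ->
  {homo a1 : x y / x < y} -> {homo a2 : x y / x < y} ->
  (forall x, (xi - a1 x) ^+ 2 = (xi - a2 x) ^+ 2) -> a1 =1 a2.
Proof.
move=> ca1 ca2 ia1 ia2 a12.
have alt x : a1 x <> a2 x -> a1 x + a2 x = 2 * xi.
  move=> /eqP ne; have /eqP := a12 x; rewrite eqf_sqr => /orP[] /eqP.
    by move=> h; case/eqP: ne; lra.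
  by lra.
move=> x; apply: contrapT => ne; have ex := alt _ ne.
have /cvgrPdist_lt : (a1 y - a2 y) @[y --> x] --> a1 x - a2 x.
  by apply: cvgB; [exact: ca1|exact: ca2].
have d0 : 0 < `|a1 x - a2 x| by rewrite normr_gt0 subr_eq0; exact/eqP.
move=> /(_ _ d0) /nbhs_ballP[e /= e0 xe].
have : ball x e (x + e / 2).
  by rewrite /ball /= opprD addNKr normrN gtr0_norm ?divr_gt0//; lra.
move=> /xe.
have xlt : x < x + e / 2 by rewrite ltrDl divr_gt0.
have [->|/eqP ney] := eqVneq (a1 (x + e / 2)) (a2 (x + e / 2)).
  by rewrite subrr subr0 ltxx.
by have := alt _ ney; have := ia1 _ _ xlt; have := ia2 _ _ xlt; lra.
Qed.

(** * Conclusion *)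

Unset Implicit Arguments.
Set Strict Implicit.
Set Printing Implicit Defensive.

Theorem theorem2p3 (R : realType) (bm bp : R)
    (hbm : 0 < bm) (hbmp : bm < bp) (hbp : bp < 3 * bm)
    (b bt : R -> R) (hb : profile bm bp b) (hbt : profile bm bp bt) :
  (exists xi0 : R, 0 < xi0 /\
    exists phi phit : R -> R,
      [/\ ground_state b xi0 phi, ground_state bt xi0 phit
        & forall x : R, phi x = phit x]) ->
  \forall x \ae (@lebesgue_measure R), bt x = b x.
Proof.
move=> [xi [xi0 [phi [phit []]]]].
move=> [[l _ [_ [_ _ eqn]]] _ cphi phi0] [[lt _ [_ [_ _ eqnt]]] _ _ _] /funext.
move=> phiE; rewrite -phiE in eqnt.
have ca := continuous_potential hbm hb.
have cat_ := continuous_potential hbm hbt.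
have cV (a : R -> R) : continuous a -> continuous (fun x => (xi - a x) ^+ 2).
  by move=> ha x; apply: cvgM; apply: cvgB; (exact: cvg_cst || exact: ha).
have cl (k : R) : continuous (fun x => k * phi x).
  by move=> x; apply: cvgM; [exact: cvg_cst|exact: cphi].
have shift x : (xi - potential b x) ^+ 2 - l = (xi - potential bt x) ^+ 2 - lt.
  apply: (mulIf (lt0r_neq0 (phi0 x))); rewrite !mulrBl.
  exact: (weak_schrodinger_potential_unique cphi (cV _ ca) (cV _ cat_)
    (cl l) (cl lt) eqn eqnt).
(* Both potentials vanish at 0, so the two eigenvalues agree. *)
have llt : l = lt by have := shift 0; rewrite !potential0; lra.
apply: ae_eq_potential.
- exact: profile_locally_integrable hbt.
- exact: profile_locally_integrable hb.
apply: (increasing_reflection_unique (xi := xi) cat_ ca).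
- exact: (potential_increasing hbm hbt).
- exact: (potential_increasing hbm hb).
- by move=> x; have := shift x; rewrite llt; lra.
Qed.
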